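(* Let $\mathrm{R}$ be a commutative unital ring and let $(X,T)$ be a ternary algebra satisfying axioms A1 and A2. Then for any $\alpha,\beta\in\mathrm{R}$ and every $n$, $$\partial_n^{(\alpha,\beta)}\big(C_n^D(X,T)\big)\subset C_{n-1}^D(X,T).$$
   Context: A ternary algebra $(X,T)$ is a set $X$ with an operation $T\colon X^3\to X$; write $T(a,b,c)$ for its value. The axioms are, for all $a,b,c,d\in X$: (A1) $T(T(a,b,c),c,d)=T\big(T(a,b,T(b,c,d)),\,T(b,c,d),\,d\big)$; (A2) $T(a,b,T(b,c,d))=T\big(a,\,T(a,b,c),\,T(T(a,b,c),c,d)\big)$. $C_n(X)=\mathrm{R}\langle X^{n+2}\rangle$ ($n\ge -1$) is the free $\mathrm{R}$-module on $(n+2)$-tuples $(x_0,\ldots,x_{n+1})$ of elements of $X$. For $x=(x_0,\ldots,x_{n+1})$ and $1\le i\le n$ let $x[i]=(x_0,\ldots,x_{i-1},T(x_{i-1},x_i,x_{i+1}),x_{i+1},\ldots,x_{n+1})$. For $n\ge 0$ and $0\le i\le n$ define $\mathrm{R}$-linear maps $d_i^{n,L},d_i^{n,R}\colon C_n(X)\to C_{n-1}(X)$ inductively on tuples by $d_0^{n,L}(x)=(x_1,\ldots,x_{n+1})$ and $d_i^{n,L}(x)=d_{i-1}^{n,L}(x[i])$ for $1\le i\le n$; $d_n^{n,R}(x)=(x_0,\ldots,x_n)$ and $d_{i-1}^{n,R}(x)=d_i^{n,R}(x[i])$ for $1\le i\le n$. Set $\partial_n^L=\sum_{i=0}^n(-1)^i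 d_i^{n,L}$, $\partial_n^R=\sum_{i=0}^n(-1)^i d_i^{n,R}$, and $\partial_n^{(\alpha,\beta)}=\alpha\partial_n^L+\beta\partial_n^R$. The degenerate submodule $C_n^D(X,T)\subset C_n(X)$ is, for $n\ge 1$, the free $\mathrm{R}$-module generated by those tuples $(x_0,\ldots,x_{n+1})$ for which there is an index $j$ with $0\le j\le n-1$ and $x_{j+1}=T(x_j,x_{j+1},x_{j+2})$; for $n<1$, $C_n^D(X,T)=0$. *)

(* Defs.v *)
From HB Require Import structures.
From mathcomp Require Import all_boot all_algebra.
From mathcomp Require Import boolp classical_sets finmap.
From mathcomp.multinomials Require Import monalg.

Set Implicit Arguments.
Unset Strict Implicit.
Unset Printing Implicit Defensive.

Import GRing.Theory.
Local Open Scope classical_set_scope.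
Local Open Scope ring_scope.

(* The free module R<B> on an arbitrary type B is monalg's {malg R[_]}: finitely
   supported functions B -> R.  monalg provides the R-module structure only when
   1 != 0 in R; it is rebuilt here so that the zero ring is allowed as well.
   {classic B} is B with its classical choiceType structure. *)
Definition free_module (R : pzRingType) (B : Type) : Type :=
  {malg R[{classic B}]}.

HB.instance Definition _ (R : pzRingType) (B : Type) :=
  GRing.Zmodule.on (free_module R B).

Section FreeModule.
Context (R : pzRingType) (B : Type).
Implicit Types (a : R) (b : {classic B}) (c : free_module R B).

Definition free_scale a c : free_module R B :=
  [malg b in msupp c => a * c@_b].

Lemma free_scaleE a c b : (free_scale a c)@_b = a * c@_b.
Proof. by rewrite mcoeffE; case: msuppP => //; rewrite mulr0. Qed.

Fact free_scaleA a1 a2 c :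
  free_scale a1 (free_scale a2 c) = free_scale (a1 * a2) c.
Proof. by apply/malgP => b; rewrite !free_scaleE mulrA. Qed.

Fact free_scale1 : left_id 1 free_scale.
Proof. by move=> c; apply/malgP => b; rewrite free_scaleE mul1r. Qed.

Fact free_scaleDr : right_distributive free_scale +%R.
Proof.
move=> a c1 c2; apply/malgP => b.
by rewrite mcoeffD !free_scaleE mcoeffD mulrDr.
Qed.

Fact free_scaleDl c : {morph free_scale^~ c : a1 a2 / a1 + a2}.
Proof.
by move=> a1 a2; apply/malgP => b; rewrite mcoeffD !free_scaleE mulrDl.
Qed.

HB.instance Definition _ := GRing.Zmodule_isLmodule.Build R (free_module R B)
  free_scaleA free_scale1 free_scaleDr free_scaleDl.

Definition basis (b : B) : free_module R B := << 1 *g (b : {classic B}) >>.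

End FreeModule.

Lemma mcoeff_scale (R : pzRingType) (B : Type) (a : R) (c : free_module R B)
    (b : {classic B}) : (a *: c)@_b = a * c@_b.
Proof. exact: free_scaleE. Qed.

(* The R-linear map R<B> -> R<B'> extending f : B -> B'. *)
Definition linear_ext (R : pzRingType) (B B' : Type) (f : B -> B')
    (c : free_module R B) : free_module R B' :=
  \sum_(b <- msupp c) c@_b *: basis R (f b).

Lemma linear_extEw (R : pzRingType) (B B' : Type) (f : B -> B')
    (c : free_module R B) (D : {fset {classic B}}) : (msupp c `<=` D)%fset ->
  linear_ext f c = \sum_(b <- D) c@_b *: basis R (f b).
Proof.
move=> sub; rewrite /linear_ext (big_fset_incl _ sub) // => b _ bNc.
by rewrite mcoeff_outdom // scale0r.
Qed.

Fact linear_ext_is_linear (R : pzRingType) (B B' : Type) (f : B -> B') :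
  linear (@linear_ext R B B' f).
Proof.
move=> a c1 c2; pose D := (msupp (a *: c1 + c2) `|` (msupp c1 `|` msupp c2))%fset.
have sub0 : (msupp (a *: c1 + c2) `<=` D)%fset by rewrite fsubsetUl.
have sub1 : (msupp c1 `<=` D)%fset by rewrite fsubsetU // fsubsetUl orbT.
have sub2 : (msupp c2 `<=` D)%fset by rewrite fsubsetU // fsubsetUr orbT.
rewrite (linear_extEw f sub0) (linear_extEw f sub1) (linear_extEw f sub2).
rewrite scaler_sumr -big_split /=; apply: eq_bigr => b _.
by rewrite mcoeffD mcoeff_scale scalerA scalerDl.
Qed.

HB.instance Definition _ (R : pzRingType) (B B' : Type) (f : B -> B') :=
  GRing.isLinear.Build R (free_module R B) (free_module R B') *:%R
    (@linear_ext R B B' f) (@linear_ext_is_linear R B B' f).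

Lemma linear_ext_basis (R : pzRingType) (B B' : Type) (f : B -> B') (b : B) :
  linear_ext f (basis R b) = basis R (f b).
Proof.
rewrite (linear_extEw _ (@msuppU_le _ _ _ _)) big_seq_fset1.
by rewrite mcoeffUU scale1r.
Qed.

Section TernaryAlgebra.
Context (X : Type) (T : X -> X -> X -> X).

Definition axiom_A1 : Prop := forall a b c d : X,
  T (T a b c) c d = T (T a b (T b c d)) (T b c d) d.

Definition axiom_A2 : Prop := forall a b c d : X,
  T a b (T b c d) = T a (T a b c) (T (T a b c) c d).

(* The entry x_i of x = (x_0, ..., x_m); only meaningful for i <= m, since
   inord sends larger i to a default index. *)
Definition entry m (x : m.+1.-tuple X) (i : nat) : X := tnth x (inord i).

(* x[i], for 1 <= i <= n. *)
Definition modify n (i : nat) (x : n.+2.-tuple X) : n.+2.-tuple X :=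
  [tuple if j == i :> nat then T (entry x i.-1) (entry x i) (entry x i.+1)
         else tnth x j | j < n.+2].

(* d_i^{n,L} on tuples, for i <= n. *)
Fixpoint faceL n (i : nat) (x : n.+2.-tuple X) : n.+1.-tuple X :=
  if i is i'.+1 then faceL i' (modify i x)
  else [tuple entry x j.+1 | j < n.+1].

(* d_{n-k}^{n,R} on tuples, for k <= n: the defining recursion of d_i^{n,R}
   goes downwards from i = n. *)
Fixpoint faceR_rec n (k : nat) (x : n.+2.-tuple X) : n.+1.-tuple X :=
  if k is k'.+1 then faceR_rec k' (modify (n - k') x)
  else [tuple entry x j | j < n.+1].

Definition faceR n (i : nat) (x : n.+2.-tuple X) : n.+1.-tuple X :=
  faceR_rec (n - i) x.

Lemma faceR_last n (x : n.+2.-tuple X) :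
  faceR n x = [tuple entry x j | j < n.+1].
Proof. by rewrite /faceR subnn. Qed.

Lemma faceR_pred n i (x : n.+2.-tuple X) : (1 <= i <= n)%N ->
  faceR i.-1 x = faceR i (modify i x).
Proof.
case: i => [|i] //= lt_in.
by rewrite /faceR -(subnSK lt_in) /= subKn.
Qed.

(* (x_0, ..., x_{n+1}), with m = n + 1, has an index 0 <= j <= n - 1 such that
   x_{j+1} = T(x_j, x_{j+1}, x_{j+2}). *)
Definition degenerate m (x : m.+1.-tuple X) : Prop :=
  exists j : nat, (j.+2 <= m)%N /\
    entry x j.+1 = T (entry x j) (entry x j.+1) (entry x j.+2).

Context (R : comPzRingType).

(* chain m is R<X^{m+1}>, i.e. C_{m-1}(X), so that m : nat covers all the
   degrees n = m - 1 >= -1. *)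
Definition chain (m : nat) : lmodType R := free_module R (m.+1.-tuple X).

Definition dL n (i : nat) : chain n.+1 -> chain n := linear_ext (@faceL n i).
Definition dR n (i : nat) : chain n.+1 -> chain n := linear_ext (@faceR n i).

Definition boundaryL n (c : chain n.+1) : chain n :=
  \sum_(i < n.+1) (-1) ^+ i *: dL i c.
Definition boundaryR n (c : chain n.+1) : chain n :=
  \sum_(i < n.+1) (-1) ^+ i *: dR i c.

(* The map from C_n(X) = chain n.+1 to C_{n-1}(X) = chain n. *)
Definition boundary (alpha beta : R) n (c : chain n.+1) : chain n :=
  alpha *: boundaryL c + beta *: boundaryR c.

(* The submodule of C_{m-1}(X) = chain m spanned by the degenerate tuples. *)
Definition degenerate_chain m : set (chain m) :=
  [set c | exists (k : nat) (a : 'I_k -> R) (x : 'I_k -> m.+1.-tuple X),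
    (forall i, degenerate (x i)) /\ c = \sum_(i < k) a i *: basis R (x i)].

Lemma degenerate_chain_low m : (m < 2)%N -> @degenerate_chain m = [set 0]%classic.
Proof.
move=> m2; apply/seteqP; split=> [c [[|k] [a [x [degx ->]]]]|_ ->] /=.
- by rewrite big_ord0.
- by have [j [/leq_trans /(_ m2)]] := degx ord0.
- have x (i : 'I_0) : m.+1.-tuple X by case: i.
  by exists 0%N, (fun=> 0), x; rewrite big_ord0; split=> // -[].
Qed.

End TernaryAlgebra.

Arguments boundary {X} T {R} alpha beta {n} c.
Arguments degenerate_chain {X} T R m.

(* Main.v *)
Require Import Defs.
From mathcomp Require Import all_boot all_algebra.
From mathcomp Require Import boolp classical_sets.
From mathcomp Require Import zify.

(** Let [x] be degenerate at position [p], that is [x_p = T(x_{p-1},x_p,x_{p+1})].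
    This says exactly that [x[p] = x], so the recursion defining the faces gives
    [d_p(x) = d_{p-1}(x[p]) = d_{p-1}(x)] on the left and
    [d_{p-1}(x) = d_p(x[p]) = d_p(x)] on the right.  These two faces occur in the
    alternating sum with opposite signs and cancel.  Each remaining face is a
    degenerate tuple, so every basis element of the degenerate module has its
    boundary in the degenerate module, and linearity concludes
    ([alternating_sum_degenerate]).

    The remaining left faces are treated in [degenerate_faceL].  The face
    [d_i^L(x)] is [(y_1,...,y_i,x_{i+1},...,x_{n+1})], where the [y_k] solve the
    downward recursion [y_k = T(x_{k-1},x_k,y_{k+1})] starting from
    [y_{i+1} = x_{i+1}].  If [i < p-1] the degenerate triple survives unchanged.
    If [i > p], put [a,b,c = x_{p-1},x_p,x_{p+1}] and [d = y_{p+2}], so that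
    [T(a,b,c) = b]; then A1 reads
    [T(b,c,d) = T(T(a,b,T(b,c,d)),T(b,c,d),d)], which is
    [y_{p+1} = T(y_p,y_{p+1},y_{p+2})].

    Right faces follow by reversing tuples: reversal exchanges right and left
    faces once [T] is replaced by [T'(a,b,c) = T(c,b,a)] ([faceR_rec_rev]), it
    preserves degeneracy, and A1 for [T'] is A2 for [T]. *)

Set Implicit Arguments.
Unset Strict Implicit.
Unset Printing Implicit Defensive.

Import GRing.Theory.
Local Open Scope ring_scope.

Section Tuples.
Context (X : Type).
Implicit Types T : X -> X -> X -> X.

Lemma entry_nth x0 m (x : m.+1.-tuple X) i : (i <= m)%N ->
  entry x i = nth x0 x i.
Proof. by move=> le_im; rewrite /entry (tnth_nth x0) inordK. Qed.

Lemma entryP m (x y : m.+1.-tuple X) :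
  (forall i, (i <= m)%N -> entry x i = entry y i) -> x = y.
Proof.
move=> eq_xy; apply: eq_from_tnth => i.
by have := eq_xy i (ltn_ord i); rewrite /entry inord_val.
Qed.

Lemma entry_mktuple m (f : 'I_m.+1 -> X) i : (i <= m)%N ->
  entry [tuple f j | j < m.+1] i = f (inord i).
Proof. by move=> le_im; rewrite /entry tnth_mktuple. Qed.

Lemma entry_modify T n (x : n.+2.-tuple X) i j : (j <= n.+1)%N ->
  entry (modify T i x) j =
  if j == i then T (entry x i.-1) (entry x i) (entry x i.+1) else entry x j.
Proof. by move=> le_jn; rewrite entry_mktuple // inordK. Qed.

Lemma modify_id T n (x : n.+2.-tuple X) i :
  entry x i = T (entry x i.-1) (entry x i) (entry x i.+1) -> modify T i x = x.
Proof.
move=> xi; apply: entryP => j le_jn; rewrite entry_modify // -xi.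
by case: eqP => // ->.
Qed.

Lemma entry_faceL_ge T n (x : n.+2.-tuple X) i k : (i <= k <= n)%N ->
  entry (faceL T i x) k = entry x k.+1.
Proof.
elim: i x => [|i IHi] x /andP[le_ik le_kn] /=.
  by rewrite entry_mktuple // inordK.
rewrite IHi; last by rewrite ltnW.
by rewrite entry_modify // eqSS gtn_eqF.
Qed.

(** The first [i] entries of a left face satisfy a downward recursion seeded
    by its entry at position [i]; together with [entry_faceL_ge] this
    determines the face without reference to the iterated modifications. *)
Lemma entry_faceL_lt T n (x : n.+2.-tuple X) i k : (k < i <= n)%N ->
  entry (faceL T i x) k =
  T (entry x k) (entry x k.+1) (entry (faceL T i x) k.+1).
Proof.
elim: i x => [|i IHi] x /andP[] //.
rewrite ltnS leq_eqVlt => /orP[/eqP-> | lt_ki] lt_in /=.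
  by rewrite !entry_faceL_ge ?entry_modify ?eqxx ?gtn_eqF //; lia.
by rewrite IHi ?lt_ki ?(ltnW lt_in) // !entry_modify ?ltn_eqF //; lia.
Qed.

(** A face with [i < j] leaves the degenerate triple untouched and only shifts
    it by one position.  A face with [i > j.+1] rewrites it, and A1 makes the
    rewritten triple degenerate.  The two excluded faces are those that cancel
    in the boundary. *)
Lemma degenerate_faceL T n (x : n.+2.-tuple X) i j : axiom_A1 T ->
    (i <= n)%N -> (j < n)%N -> i != j -> i != j.+1 ->
    entry x j.+1 = T (entry x j) (entry x j.+1) (entry x j.+2) ->
  degenerate T (faceL T i x).
Proof.
move=> A1 le_in lt_jn ne_ij ne_ij1 xj.
have [lt_ij | le_ji] := ltnP i j.
  case: j lt_jn ne_ij ne_ij1 xj lt_ij => // j lt_jn _ _ xj lt_ij.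
  by exists j; split=> //; rewrite !entry_faceL_ge //; lia.
have lt_j1i : (j.+1 < i)%N by lia.
exists j; split; first exact: leq_trans lt_j1i le_in.
rewrite (@entry_faceL_lt _ _ _ _ j) ?(@entry_faceL_lt _ _ _ _ j.+1); try lia.
(* Both sides are now expressed by the old triple and the entry j.+2 of the
   face; degeneracy of x turns the left-hand side of A1 into T b c d. *)
have := A1 (entry x j) (entry x j.+1) (entry x j.+2) (entry (faceL T i x) j.+2).
by rewrite -xj.
Qed.

Definition opposite T : X -> X -> X -> X := fun a b c => T c b a.

Lemma axiom_A1_opposite T : axiom_A2 T -> axiom_A1 (opposite T).
Proof. by move=> A2 a b c d; apply: A2. Qed.

Lemma entry_rev m (x : m.+1.-tuple X) i : (i <= m)%N ->
  entry (rev_tuple x) i = entry x (m - i).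
Proof.
move=> le_im; have x0 := entry x 0.
rewrite !(entry_nth x0) ?leq_subr //.
by rewrite nth_rev size_tuple.
Qed.

Lemma modify_rev T n (x : n.+2.-tuple X) i : (0 < i <= n)%N ->
  rev_tuple (modify T i x) = modify (opposite T) (n.+1 - i) (rev_tuple x).
Proof.
move=> /andP[i_gt0 le_in]; apply: entryP => j le_jn.
rewrite entry_modify // !entry_rev ?entry_modify //; try lia.
have -> : (n.+1 - j == i)%N = (j == n.+1 - i)%N by lia.
case: eqP => // _; rewrite /opposite.
congr (T (entry x _) (entry x _) (entry x _)); lia.
Qed.

(** Right faces are left faces seen in a mirror, so that A2 is used only in the
    form of A1 for [opposite T]. *)
Lemma faceR_rec_rev T n (x : n.+2.-tuple X) k : (k <= n)%N ->
  faceR_rec T k x = rev_tuple (faceL (opposite T) k (rev_tuple x)).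
Proof.
elim: k x => [|k IHk] x le_kn /=.
  apply: entryP => i le_in.
  rewrite entry_rev // !entry_mktuple ?leq_subr // !inordK ?ltnS ?leq_subr //.
  by rewrite entry_rev; [congr entry; lia | lia].
rewrite IHk ?(ltnW le_kn) // modify_rev; last by lia.
by congr (rev_tuple (faceL _ _ (modify _ _ _))); lia.
Qed.

Lemma degenerate_rev T m (x : m.+1.-tuple X) :
  degenerate (opposite T) x -> degenerate T (rev_tuple x).
Proof.
move=> [j [le_jm xj]]; exists (m - j.+2)%N; split; first by lia.
rewrite !entry_rev; try lia.
have -> : (m - (m - j.+2).+1)%N = j.+1 by lia.
have -> : (m - (m - j.+2))%N = j.+2 by lia.
by have -> : (m - (m - j.+2).+2)%N = j by lia.
Qed.

Lemma degenerate_faceR T n (x : n.+2.-tuple X) i j : axiom_A2 T ->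
    (i <= n)%N -> (j < n)%N -> i != j -> i != j.+1 ->
    entry x j.+1 = T (entry x j) (entry x j.+1) (entry x j.+2) ->
  degenerate T (faceR T i x).
Proof.
move=> A2 le_in lt_jn ne_ij ne_ij1 xj.
rewrite /faceR faceR_rec_rev ?leq_subr //; apply: degenerate_rev.
(* Positions j, j.+1, j.+2 are reversed, so the triple now starts at
   n.+1 - j.+2 = n - j.+1. *)
apply: (@degenerate_faceL _ _ _ _ (n - j.+1)); try lia.
  exact: axiom_A1_opposite.
rewrite !entry_rev; try lia.
have -> : (n.+1 - (n - j.+1).+1)%N = j.+1 by lia.
have -> : (n.+1 - (n - j.+1))%N = j.+2 by lia.
by have -> : (n.+1 - (n - j.+1).+2)%N = j by lia.
Qed.

End Tuples.

Section Chains.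
Context (R : comPzRingType) (X : Type) (T : X -> X -> X -> X).

Lemma degenerate_chain0 m : degenerate_chain T R m 0.
Proof.
have x (i : 'I_0) : m.+1.-tuple X by case: i.
by exists 0%N, (fun=> 0), x; split=> [[]//|]; rewrite big_ord0.
Qed.

Lemma degenerate_chainD m (c1 c2 : chain X R m) :
  degenerate_chain T R m c1 -> degenerate_chain T R m c2 ->
  degenerate_chain T R m (c1 + c2).
Proof.
move=> [k1 [a1 [x1 [deg1 ->]]]] [k2 [a2 [x2 [deg2 ->]]]].
pose glue Y (f1 : 'I_k1 -> Y) (f2 : 'I_k2 -> Y) (i : 'I_(k1 + k2)) :=
  match split i with inl i1 => f1 i1 | inr i2 => f2 i2 end.
exists (k1 + k2)%N, (glue _ a1 a2), (glue _ x1 x2); split.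
  by move=> i; rewrite /glue; case: (split i).
rewrite big_split_ord; congr (_ + _); apply: eq_bigr => i _; rewrite /glue.
- by rewrite (unsplitK (inl i)).
- by rewrite (unsplitK (inr i)).
Qed.

Lemma degenerate_chainZ m a (c : chain X R m) :
  degenerate_chain T R m c -> degenerate_chain T R m (a *: c).
Proof.
move=> [k [b [x [deg ->]]]]; exists k, (fun i => a * b i), x; split=> //.
by rewrite scaler_sumr; apply: eq_bigr => i _; rewrite scalerA.
Qed.

Lemma degenerate_chain_basis m (x : m.+1.-tuple X) :
  degenerate T x -> degenerate_chain T R m (basis R x).
Proof.
by move=> degx; exists 1%N, (fun=> 1), (fun=> x); rewrite big_ord1 scale1r.
Qed.

Lemma degenerate_chain_sum m (I : Type) (r : seq I) (P : pred I)
    (F : I -> chain X R m) :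
  (forall i, P i -> degenerate_chain T R m (F i)) ->
  degenerate_chain T R m (\sum_(i <- r | P i) F i).
Proof.
by move=> degF; apply: big_ind => //;
   [exact: degenerate_chain0 | exact: degenerate_chainD].
Qed.

Lemma linear_ext_sum_basis (B B' I : Type) (f : B -> B') (r : seq I)
    (P : pred I) (a : I -> R) (x : I -> B) :
  linear_ext f (\sum_(l <- r | P l) a l *: basis R (x l)) =
  \sum_(l <- r | P l) a l *: basis R (f (x l)).
Proof.
rewrite (linear_sum (linear_ext f)); apply: eq_bigr => l _.
rewrite (linearZ_LR (linear_ext f)); congr (_ *: _).
exact: linear_ext_basis.
Qed.

(** The argument shared by left and right boundaries: on a degenerate tuple,
    two consecutive faces coincide, hence cancel in the alternating sum, and the
    others are degenerate. *)
Lemma alternating_sum_degenerate n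
    (face : nat -> n.+2.-tuple X -> n.+1.-tuple X) (c : chain X R n.+1) :
    (forall x j, (j < n)%N ->
       entry x j.+1 = T (entry x j) (entry x j.+1) (entry x j.+2) ->
       face j.+1 x = face j x /\
       forall i, (i <= n)%N -> i != j -> i != j.+1 -> degenerate T (face i x)) ->
    degenerate_chain T R n.+1 c ->
  degenerate_chain T R n
    (\sum_(i < n.+1) (-1) ^+ i *: linear_ext (face i) c : chain X R n).
Proof.
move=> faceP [k [a [x [degx ->]]]].
pose alt l : chain X R n := \sum_(i < n.+1) (-1) ^+ i *: basis R (face i (x l)).
have -> : \sum_(i < n.+1) (-1) ^+ i *:
      linear_ext (face i) (\sum_(l < k) a l *: basis R (x l))
    = \sum_(l < k) a l *: alt l.
  under eq_bigr => i _ do rewrite linear_ext_sum_basis scaler_sumr.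
  rewrite exchange_big; apply: eq_bigr => l _; rewrite /alt scaler_sumr.
  apply: eq_bigr => i _.
  by rewrite !scalerA mulrC.
apply: degenerate_chain_sum => l _; apply: degenerate_chainZ.
have [j [lt_jn xj]] := degx l; rewrite ltnS in lt_jn.
have [eq_face deg_face] := faceP _ _ lt_jn xj.
pose i0 : 'I_n.+1 := Ordinal (ltnW lt_jn : (j < n.+1)%N).
pose i1 : 'I_n.+1 := Ordinal (lt_jn : (j.+1 < n.+1)%N).
rewrite /alt (bigD1 i0) //= (bigD1 i1) /=; last by rewrite -val_eqE /=; lia.
rewrite eq_face addrA exprS mulN1r scaleNr subrr add0r.
apply: degenerate_chain_sum => i /andP[ne_i0 ne_i1].
apply: degenerate_chainZ; apply: degenerate_chain_basis.
by apply: deg_face; rewrite // -ltnS.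
Qed.

End Chains.

Local Open Scope classical_set_scope.

Theorem lemma2p13 (R : comPzRingType) (X : Type) (T : X -> X -> X -> X)
    (hA1 : axiom_A1 T) (hA2 : axiom_A2 T) (alpha beta : R) (n : nat) :
  boundary T alpha beta @` degenerate_chain T R n.+1 `<=` degenerate_chain T R n.
Proof.
move=> _ [c degc <-]; apply: degenerate_chainD; apply: degenerate_chainZ.
- apply: alternating_sum_degenerate degc => x j lt_jn xj; split.
    by rewrite /= modify_id.
  by move=> i le_in ne_ij ne_ij1; apply: degenerate_faceL xj.
- apply: alternating_sum_degenerate degc => x j lt_jn xj; split.
    by rewrite -[in LHS](modify_id xj) -(@faceR_pred _ _ _ j.+1).
  by move=> i le_in ne_ij ne_ij1; apply: degenerate_faceR xj.
Qed.
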